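(* Let $f\colon\mathbb{R}^d\to\mathbb{R}$ be a piecewise affine function of the form $$f(x)=\underline{f}(x)+\overline{f}(x),\quad \underline{f}(x)=\max_{i\in I}(a_i+\langle v_i,x\rangle),\quad \overline{f}(x)=\min_{j\in J}(b_j+\langle w_j,x\rangle)\qquad\forall x\in\mathbb{R}^d,$$ where $I=\{1,\dots,l\}$, $J=\{1,\dots,s\}$ and $(a_i,v_i),(b_j,w_j)\in\mathbb{R}\times\mathbb{R}^d$, and let $Df=[\underline{d}f,\overline{d}f]$ be the global codifferential mapping of $f$ associated with this decomposition. Let $x^*\in\mathbb{R}^d$, and suppose that $f$ is bounded below. For each $j\in J$ define $z_j=(b_j-\overline{f}(x^* )+\langle w_j,x^*\rangle,\,w_j)\in\overline{d}f(x^* )$ and let $(\hat a_j,\hat v_j)\in\mathbb{R}\times\mathbb{R}^d$ be the unique element with $$\{(\hat a_j,\hat v_j)\}=\operatorname{arg\,min}\big\{\|(a,v)\|^2\bigm|(a,v)\in\underline{d}f(x^* )+z_j\big\}.$$ Then the following are equivalent: (i) $x^*$ is a point of global minimum of $f$; (ii) $\hat a_j\ge0$ for every $j\in J$; (iii) for every $j\in J$ either $0\in\underline{d}f(x^* )+z_j$ or $\hat a_j>0$.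
   Context: $\mathbb{R}\times\mathbb{R}^d=\mathbb{R}^{d+1}$ is endowed with the norm $\|(a,v)\|^2=a^2+\|v\|^2$ (Euclidean). The global codifferential mapping of $f$ associated with the decomposition $f=\underline{f}+\overline{f}$ above is the pair $Df=[\underline{d}f,\overline{d}f]$ of set-valued mappings $$\underline{d}f(x)=\operatorname{co}\{(a_i-\underline{f}(x)+\langle v_i,x\rangle,\,v_i)\mid i\in I\},\quad \overline{d}f(x)=\operatorname{co}\{(b_j-\overline{f}(x)+\langle w_j,x\rangle,\,w_j)\mid j\in J\},$$ where $\operatorname{co}$ denotes the convex hull. $A+z=\{y+z\mid y\in A\}$. *)

(* Defs.v *)
From mathcomp Require Import all_boot all_order all_algebra.
From mathcomp Require Import all_classical all_reals all_analysis.

Set Implicit Arguments.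
Unset Strict Implicit.
Unset Printing Implicit Defensive.

Import Order.TTheory GRing.Theory Num.Theory.
Import numFieldNormedType.Exports.

Local Open Scope classical_set_scope.
Local Open Scope ring_scope.

Definition convex_hull (R : numDomainType) (M : lmodType R) (A : set M) :
    set M :=
  smallest (@convex_set R M) A.

Definition dotp (R : realType) (d : nat) (u v : 'rV[R]_d) : R :=
  \sum_(k < d) u 0 k * v 0 k.

(* Squared Euclidean norm of R x R^d; the library norm [`|p|] on this type is
   the sup norm. *)
Definition sqnorm (R : realType) (d : nat) (p : R * 'rV[R]_d) : R :=
  p.1 ^+ 2 + dotp p.2 p.2.

(* The seeds [a ord0 + _] and [b ord0 + _] are themselves members of the
   families, so these are the plain maximum and minimum over the nonempty index
   sets {1, ..., l+1} and {1, ..., s+1}. *)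
Definition max_affine (R : realType) (d l : nat)
    (a : 'I_l.+1 -> R) (v : 'I_l.+1 -> 'rV[R]_d) (x : 'rV[R]_d) : R :=
  \big[Num.max/a ord0 + dotp (v ord0) x]_(i < l.+1) (a i + dotp (v i) x).

Definition min_affine (R : realType) (d s : nat)
    (b : 'I_s.+1 -> R) (w : 'I_s.+1 -> 'rV[R]_d) (x : 'rV[R]_d) : R :=
  \big[Num.min/b ord0 + dotp (w ord0) x]_(j < s.+1) (b j + dotp (w j) x).

Definition hypodiff (R : realType) (d l : nat)
    (a : 'I_l.+1 -> R) (v : 'I_l.+1 -> 'rV[R]_d) (x : 'rV[R]_d) :
    set (R * 'rV[R]_d) :=
  convex_hull
    (range (fun i => (a i - max_affine a v x + dotp (v i) x, v i))).

Definition hyperdiff (R : realType) (d s : nat)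
    (b : 'I_s.+1 -> R) (w : 'I_s.+1 -> 'rV[R]_d) (x : 'rV[R]_d) :
    set (R * 'rV[R]_d) :=
  convex_hull
    (range (fun j => (b j - min_affine b w x + dotp (w j) x, w j))).

Definition translate (V : zmodType) (A : set V) (z : V) : set V :=
  [set y + z | y in A].

Definition argmin (R : realType) (T : Type) (g : T -> R) (A : set T) : set T :=
  [set p | A p /\ forall q, A q -> g p <= g q].

(* Main.v *)
Require Import Defs.
From mathcomp Require Import all_boot all_order all_algebra.
From mathcomp Require Import all_classical all_reals all_analysis.
From mathcomp Require Import ring lra.

(** Write [g_j h] for the maximum over [i] of the affine functions
    [h |-> q.1 + <q.2, h>], where [q] runs over the points generating the
    polytope [C_j = hypodiff a v xs + z_j].  Expanding the maximum and the
    minimum in [f] gives [f (xs + h) - f xs = min_j g_j h]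
    ([global_lower_boundP]).  Hence [xs] is a global minimum iff every [g_j] is
    nonnegative, and [f] is bounded below iff every [g_j] is.  It remains to
    study one polytope [C] with minimal-norm point [p = (p1, p2)], about which
    two facts are used: [|p|^2 <= <q, p>] for all [q] in [C]
    ([argmin_variational]), and [g h >= q.1 + <q.2, h>] for all [q] in [C]
    ([hull_aff_le]).

    If [g >= 0], then [p1 >= 0]: otherwise the direction [p2 / p1] would make
    all generators negative ([nonneg_argmin_ge0]).

    If [p1 = 0] and [p <> 0], then [<q.2, p2> >= |p|^2 > 0] for every generator
    [q], so [g] tends to minus infinity along [- p2].  As [g] is bounded below,
    [p1 >= 0] therefore forces [p = 0] or [p1 > 0] ([argmin_ge0_cases]).

    Conversely, a point [(q1, 0)] of [C] with [q1 >= 0] yields [g >= q1 >= 0].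
    The origin is such a point.  When only [p1 > 0] is known, boundedness below
    puts [0] in the hull of the slopes ([hull_zero_slope]), so [C] contains
    some [(q1, 0)], and [q1 * p1 >= |p|^2 >= 0] gives its sign
    ([argmin_cases_nonneg]).

    Existence of minimal-norm points comes from compactness of the simplex,
    which parametrizes the hull of a finite family ([convex_hull_range]), and
    uniqueness from the variational inequality. *)

Set Implicit Arguments.
Unset Strict Implicit.
Unset Printing Implicit Defensive.

Import Order.TTheory GRing.Theory Num.Theory.
Import numFieldNormedType.Exports.

Local Open Scope classical_set_scope.
Local Open Scope ring_scope.

(** * Euclidean structure *)

Lemma dotpC (R : realType) (d : nat) (u v : 'rV[R]_d) : dotp u v = dotp v u.
Proof. by apply: eq_bigr => k _; rewrite mulrC. Qed.

Lemma dotpDl (R : realType) (d : nat) (u v x : 'rV[R]_d) :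
  dotp (u + v) x = dotp u x + dotp v x.
Proof. by rewrite -big_split; apply: eq_bigr => k _; rewrite mxE mulrDl. Qed.

Lemma dotpZl (R : realType) (d : nat) (c : R) (u x : 'rV[R]_d) :
  dotp (c *: u) x = c * dotp u x.
Proof. by rewrite mulr_sumr; apply: eq_bigr => k _; rewrite mxE mulrA. Qed.

Lemma dotpDr (R : realType) (d : nat) (u v x : 'rV[R]_d) :
  dotp x (u + v) = dotp x u + dotp x v.
Proof. by rewrite dotpC dotpDl !(dotpC x). Qed.

Lemma dotpZr (R : realType) (d : nat) (c : R) (u x : 'rV[R]_d) :
  dotp x (c *: u) = c * dotp x u.
Proof. by rewrite dotpC dotpZl dotpC. Qed.

Lemma dotp_ge0 (R : realType) (d : nat) (u : 'rV[R]_d) : 0 <= dotp u u.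
Proof. by apply: sumr_ge0 => k _; rewrite -expr2 sqr_ge0. Qed.

Lemma dotp_eq0 (R : realType) (d : nat) (u : 'rV[R]_d) :
  dotp u u = 0 -> u = 0.
Proof.
move=> /eqP; rewrite psumr_eq0 => [/allP u0|k _]; last first.
  by rewrite -expr2 sqr_ge0.
apply/rowP => k; rewrite mxE.
by have := u0 k (mem_index_enum k); rewrite /= -expr2 sqrf_eq0 => /eqP.
Qed.

Definition pdot (R : realType) (d : nat) (p q : R * 'rV[R]_d) : R :=
  p.1 * q.1 + dotp p.2 q.2.

Lemma sqnorm_ge0 (R : realType) (d : nat) (p : R * 'rV[R]_d) : 0 <= sqnorm p.
Proof. by rewrite addr_ge0 ?sqr_ge0 ?dotp_ge0. Qed.

Lemma sqnorm_eq0 (R : realType) (d : nat) (p : R * 'rV[R]_d) :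
  sqnorm p = 0 -> p = 0.
Proof.
case: p => p1 p2 /eqP; rewrite paddr_eq0 ?sqr_ge0 ?dotp_ge0//= sqrf_eq0.
by move=> /andP[/eqP-> /eqP/dotp_eq0->].
Qed.

(** The expansion behind both the variational inequality (small [t]) and the
    uniqueness of minimizers ([t = 1]). *)
Lemma sqnorm_segment (R : realType) (d : nat) (p q : R * 'rV[R]_d) (t : R) :
  sqnorm (t *: q + (1 - t) *: p) =
  sqnorm p + 2 * t * (pdot q p - sqnorm p) + t ^+ 2 * sqnorm (q - p).
Proof.
case: p q => [p1 p2] [q1 q2]; rewrite /sqnorm /pdot /=.
rewrite -[- p2]scaleN1r !dotpDl !dotpDr !dotpZl !dotpZr (dotpC p2 q2).
rewrite /GRing.scale /=; ring.
Qed.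

(** The affine function encoded by [q]; the codifferential is a set of such
    functions of the displacement from the base point. *)
Definition aff (R : realType) (d : nat) (q : R * 'rV[R]_d) (h : 'rV[R]_d) : R :=
  q.1 + dotp q.2 h.

(** * Convex hulls of finite families *)

(** The unit-interval bounds place the simplex in a compact box. *)
Definition simplex (R : realType) (n : nat) : set 'rV[R]_n :=
  [set c | (forall i, c 0 i \in `[0, 1]) /\ \sum_i c 0 i = 1].
Arguments simplex : clear implicits.

Definition comb (R : realType) (M : lmodType R) (n : nat) (P : 'I_n -> M)
    (c : 'rV[R]_n) : M :=
  \sum_i c 0 i *: P i.

Lemma simplex_compact (R : realType) (n : nat) : compact (simplex R n).
Proof.
apply: (@compact_closedI _ [set c : 'rV[R]_n | forall i, c 0 i \in `[0, 1]]
  [set c : 'rV[R]_n | \sum_i c 0 i = 1]).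
  apply: (@rV_compact R n (fun=> `[0, 1]%classic)) => _.
  exact: segment_compact.
have : continuous (fun c : 'rV[R]_n => \sum_i c 0 i).
  apply: continuous_big => [|i _]; first exact: add_continuous.
  exact: coord_continuous.
by move=> /continuous_closedP /(_ _ (@closed_eq R 1)).
Qed.

Lemma vertex_simplex (R : realType) (n : nat) (i : 'I_n) :
  simplex R n (delta_mx 0 i).
Proof.
split=> [k|].
  by rewrite mxE in_itv/=; case: eqP => //=; rewrite ?lexx ?ler01.
rewrite (bigD1 i)//= mxE !eqxx big1 ?addr0// => k /negPf ki.
by rewrite mxE ki andbF.
Qed.

Lemma comb_vertex (R : realType) (M : lmodType R) (n : nat) (P : 'I_n -> M)
  (i : 'I_n) : comb P (delta_mx 0 i) = P i.
Proof.
rewrite /comb (bigD1 i)//= mxE !eqxx scale1r big1 ?addr0// => k /negPf ki.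
by rewrite mxE ki andbF scale0r.
Qed.

Lemma simplex_convex (R : realType) (n : nat) (c c' : 'rV[R]_n) (t : R) :
  0 <= t <= 1 -> simplex R n c -> simplex R n c' ->
  simplex R n (t *: c + (1 - t) *: c').
Proof.
move=> /andP[t0 t1] [c01 c1] [c'01 c'1]; split=> [i|].
  have := c01 i; have := c'01 i.
  rewrite !in_itv !mxE /= => /andP[? ?] /andP[? ?].
  by apply/andP; split; nra.
under eq_bigr do rewrite !mxE.
by rewrite big_split /= -!mulr_sumr c1 c'1; ring.
Qed.

(** Convexity in terms of a bare scalar, free of the type [{i01 R}] of
    coefficients bundled with their bounds. *)
Lemma convex_setE (R : realType) (M : lmodType R) (A : set M) :
  @convex_set R M A <-> forall (x y : M) (t : R),
    0 <= t <= 1 -> A x -> A y -> A (t *: x + (1 - t) *: y).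
Proof.
split=> [cA x y t t01 Ax Ay|cA x y t].
  pose l := Itv01 (andP t01).1 (andP t01).2.
  by have := cA x y l; rewrite !inE; exact.
by rewrite !inE => Ax Ay; apply: cA => //; rewrite ge0 le1.
Qed.

(** Summed along the index set, the pairs (total weight, weighted sum) stay in
    the cone over [{1} x A]; adding two elements of that cone only takes a
    two-point convex combination.  Total weight [1] then gives a point of [A]. *)
Lemma convex_set_comb (R : realType) (M : lmodType R) (A : set M) (n : nat)
    (P : 'I_n -> M) (c : 'rV[R]_n) :
  @convex_set R M A -> (forall i, A (P i)) -> simplex R n c -> A (comb P c).
Proof.
move=> cA AP [c01 c1].
(* The vertex of the cone is a separate case because [A] may be empty. *)
pose K (t : R) (y : M) :=
  0 <= t /\ (t = 0 /\ y = 0 \/ exists2 x, A x & y = t *: x).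
have : K (\sum_i c 0 i) (comb P c).
  apply: big_ind2 => [|t y t' y' [t0 Ky] [t'0 Ky']|i _].
  - by split=> //; left.
  - split; first exact: addr_ge0.
    case: Ky Ky' => [[-> ->]|[x Ax ->]]; first by rewrite !add0r.
    case=> [[-> ->]|[x' Ax' ->]]; first by rewrite !addr0; right; exists x.
    have [tt0|tt0] := eqVneq (t + t') 0.
      have -> : t = 0 by lra.
      have -> : t' = 0 by lra.
      by left; rewrite !scale0r !addr0.
    right; exists (t / (t + t') *: x + (1 - t / (t + t')) *: x').
      apply: (convex_setE A).1 => //.
      rewrite divr_ge0 ?addr_ge0//= ler_pdivrMr ?mul1r ?lerDl//.
      by rewrite lt0r tt0 addr_ge0.
    rewrite scalerDr !scalerA mulrBr mulr1 mulrC divfK//.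
    by rewrite addrAC subrr add0r.
  - have := c01 i; rewrite in_itv/= => /andP[c0 _]; split=> //.
    by right; exists (P i).
rewrite c1 => -[_ [[/eqP]|[x Ax ->]]]; first by rewrite oner_eq0.
by rewrite scale1r.
Qed.

Lemma convex_hull_range (R : realType) (M : lmodType R) (n : nat)
    (P : 'I_n -> M) :
  convex_hull (range P) = comb P @` simplex R n.
Proof.
apply/seteqP; split=> [|_ [c sc <-]].
- apply: smallest_sub => [|_ [i _ <-]]; last first.
    by exists (delta_mx 0 i); [exact: vertex_simplex|exact: comb_vertex].
  apply/convex_setE => _ _ t t01 [c sc <-] [c' sc' <-].
  exists (t *: c + (1 - t) *: c'); first exact: simplex_convex.
  rewrite /comb !scaler_sumr -big_split; apply: eq_bigr => i _.
  by rewrite !mxE !scalerA /= -scalerDl.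
- move=> A [cA PA]; apply: convex_set_comb sc => // i; apply: PA.
  by exists i.
Qed.

Lemma convex_convex_hull (R : realType) (M : lmodType R) (A : set M) :
  @convex_set R M (convex_hull A).
Proof.
apply/convex_setE => x y t t01 hx hy B BA.
exact: ((convex_setE B).1 BA.1 _ _ _ t01 (hx B BA) (hy B BA)).
Qed.

Lemma translate_convex_hull (R : realType) (M : lmodType R) (n : nat)
    (P : 'I_n -> M) (z : M) :
  translate (convex_hull (range P)) z = convex_hull (range (fun i => P i + z)).
Proof.
have E c : simplex R n c -> comb (fun i => P i + z) c = comb P c + z.
  move=> [_ c1]; rewrite -[z in RHS]scale1r -c1 scaler_suml -big_split.
  by apply: eq_bigr => i _; rewrite scalerDr.
rewrite !convex_hull_range; apply/seteqP; split.
  by move=> _ [_ [c sc <-] <-]; exists c => //; exact: E.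
by move=> _ [c sc <-]; rewrite E//; exists (comb P c) => //; exists c.
Qed.

(** * Points of minimal norm *)

(** Moving from [p] towards [q] changes the squared norm at rate
    [2 * (pdot q p - sqnorm p)], which cannot be negative at a minimizer. *)
Lemma argmin_variational (R : realType) (d : nat) (A : set (R * 'rV[R]_d))
    (p q : R * 'rV[R]_d) :
  @convex_set R (R * 'rV[R]_d)%type A -> argmin (@sqnorm R d) A p -> A q ->
  sqnorm p <= pdot q p.
Proof.
move=> cA [Ap pmin] Aq; rewrite leNgt; apply/negP => qp.
set e := sqnorm p - pdot q p; have e0 : 0 < e by rewrite subr_gt0.
set N := sqnorm (q - p); have N0 : 0 <= N := sqnorm_ge0 (q - p).
have eN : 0 < e + N by lra.
(* This step is at most [1], and for it the quadratic term [t ^+ 2 * N] is at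
   most [t * e], half of the first-order decrease [2 * t * e]. *)
set t := e / (e + N).
have t0 : 0 < t by rewrite divr_gt0.
have tE : t * (e + N) = e by rewrite divfK// gt_eqF.
have t01 : 0 <= t <= 1 by nra.
have := pmin _ ((convex_setE A).1 cA q p t t01 Aq Ap).
rewrite sqnorm_segment -/N -opprB -/e.
have tN : t * N <= e by nra.
nra.
Qed.

Lemma argmin_sqnorm_unique (R : realType) (d : nat) (A : set (R * 'rV[R]_d))
    (p : R * 'rV[R]_d) :
  @convex_set R (R * 'rV[R]_d)%type A -> argmin (@sqnorm R d) A p ->
  [set p] = argmin (@sqnorm R d) A.
Proof.
move=> cA pmin; apply/seteqP; split=> [_ ->//|q qmin].
have pq := argmin_variational cA pmin qmin.1.
have qp := qmin.2 _ pmin.1.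
have := sqnorm_segment p q 1.
rewrite subrr scale1r scale0r addr0 => E.
have /sqnorm_eq0/subr0_eq// : sqnorm (q - p) = 0.
by have := sqnorm_ge0 (q - p); lra.
Qed.

Lemma continuous_sqnorm_comb (R : realType) (d n : nat)
    (P : 'I_n -> R * 'rV[R]_d) :
  continuous (fun c : 'rV[R]_n => sqnorm (comb P c)).
Proof.
have csum (F : 'I_n -> R) : continuous (fun c : 'rV[R]_n => \sum_i c 0 i * F i).
  apply: continuous_big => [|i _]; first exact: add_continuous.
  by move=> c; exact: (cvgM (@coord_continuous R 1 n 0 i c) (cvg_cst (F i))).
have E c : sqnorm (comb P c) =
    (\sum_i c 0 i * (P i).1) * (\sum_i c 0 i * (P i).1) +
    \sum_k (\sum_i c 0 i * (P i).2 0 k) * (\sum_i c 0 i * (P i).2 0 k).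
  rewrite /sqnorm /comb expr2; congr (_ * _ + _).
  - by rewrite (raddf_sum fst).
  - by rewrite (raddf_sum fst).
  - rewrite (raddf_sum snd); apply: eq_bigr => k _.
    by rewrite summxE; congr (_ * _); apply: eq_bigr => i _; rewrite mxE.
rewrite (funext E) => c; apply: (cvgD (cvgM (csum _ c) (csum _ c))).
apply: (@continuous_big _ _ _ _ xpredT) => [|k _ {}c]; first exact: add_continuous.
exact: (cvgM (csum _ c) (csum _ c)).
Qed.

(** The norm is minimized over the compact simplex of coefficients rather than
    over the hull itself. *)
Lemma argmin_hull_exists (R : realType) (d n : nat)
    (P : 'I_n.+1 -> R * 'rV[R]_d) :
  exists p, argmin (@sqnorm R d) (convex_hull (range P)) p.
Proof.
have [|c /[!inE] sc cmin] := EVT_min_rV _ (@simplex_compact R n.+1)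
    (continuous_subspaceT (@continuous_sqnorm_comb R d n.+1 P)).
  by exists (delta_mx 0 ord0); exact: vertex_simplex.
exists (comb P c); rewrite convex_hull_range; split; first by exists c.
by move=> _ [c' sc' <-]; apply: cmin; rewrite inE.
Qed.

(** * Maxima of affine functions and their polytopes *)

(** The points whose affine function is at most the maximum at [h] form a
    half-space, so it contains the hull as soon as it contains the generators. *)
Lemma hull_aff_le (R : realType) (d n : nat) (P : 'I_n.+1 -> R * 'rV[R]_d)
    (q : R * 'rV[R]_d) (h : 'rV[R]_d) :
  convex_hull (range P) q -> exists i, aff q h <= aff (P i) h.
Proof.
case: (@arg_maxP _ R _ ord0 xpredT (fun i => aff (P i) h)) => // i _ imax.
suff H : convex_hull (range P) `<=` [set p | aff p h <= aff (P i) h].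
  by move=> /H; exists i.
apply: smallest_sub => [|_ [k _ <-]]; last exact: imax.
apply/convex_setE => x y t /andP[t0 t1] /= xm ym.
have -> : aff (t *: x + (1 - t) *: y) h = t * aff x h + (1 - t) * aff y h.
  by rewrite /aff /= dotpDl !dotpZl /GRing.scale /=; ring.
nra.
Qed.

(** Along [- u] every affine function would decrease at rate at least [e], and
    so would their maximum, against the lower bound [m]. *)
Lemma no_common_ascent (R : realType) (d n : nat) (P : 'I_n.+1 -> R * 'rV[R]_d)
    (m e : R) (u : 'rV[R]_d) :
  (forall h, exists i, m <= aff (P i) h) ->
  0 < e -> ~ (forall i, e <= dotp (P i).2 u).
Proof.
move=> Pm e0 Pu; pose B := \sum_i `|(P i).1|; pose t := (B + `|m| + 1) / e.
(* At [- t *: u] all the functions have dropped from at most [B] to at most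
   [- `|m| - 1], which is below [m]. *)
have [i] := Pm (- t *: u); rewrite /aff dotpZr leNgt => /negP; apply.
have PB : (P i).1 <= B.
  by rewrite /B (bigD1 i)//= ler_wpDr ?ler_norm ?sumr_ge0.
have B0 : 0 <= B by rewrite sumr_ge0.
have mm := ler_norm (- m); rewrite normrN in mm.
have tE : t * e = B + `|m| + 1 by rewrite divfK// gt_eqF.
have t0 : 0 <= t.
  by apply: divr_ge0; [rewrite !addr_ge0|exact: ltW].
have := ler_wpM2l t0 (Pu i).
rewrite tE; lra.
Qed.

(** If the hull of the slopes missed [0], its minimal-norm point would be a
    direction of common ascent.  Forgetting the constant terms, instead of
    projecting, keeps the slopes in [R * 'rV_d], where minimal-norm points are
    available. *)
Lemma hull_zero_slope (R : realType) (d n : nat) (P : 'I_n.+1 -> R * 'rV[R]_d)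
    (m : R) :
  (forall h, exists i, m <= aff (P i) h) ->
  exists2 q, convex_hull (range P) q & q.2 = 0.
Proof.
move=> Pm; pose S i : R * 'rV[R]_d := (0, (P i).2).
have [u umin] := argmin_hull_exists S.
have := umin.1; rewrite convex_hull_range => -[c sc uE].
exists (comb P c); first by rewrite convex_hull_range; exists c.
have u2E : (comb P c).2 = u.2.
  by rewrite -uE /comb !(raddf_sum snd).
have u1 : u.1 = 0.
  by rewrite -uE /comb (raddf_sum fst) big1// => i _; rewrite /= scaler0.
rewrite u2E; apply/dotp_eq0/eqP; apply: contrapT => /negP u0.
have {}u0 : 0 < dotp u.2 u.2 by rewrite lt0r u0 dotp_ge0.
apply: (no_common_ascent Pm u0 (u := u.2)) => i.
have Si : convex_hull (range S) (S i) by apply: sub_gen_smallest; exists i.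
have := argmin_variational (@convex_convex_hull _ _ _) umin Si.
by rewrite /sqnorm /pdot u1 expr0n/= mul0r !add0r.
Qed.

(** If [p.1 < 0], dividing [0 < sqnorm p <= pdot q p] by [p.1] says that all the
    affine functions are negative at [p.1^-1 *: p.2]. *)
Lemma nonneg_argmin_ge0 (R : realType) (d n : nat)
    (P : 'I_n.+1 -> R * 'rV[R]_d) (p : R * 'rV[R]_d) :
  argmin (@sqnorm R d) (convex_hull (range P)) p ->
  (forall h, exists i, 0 <= aff (P i) h) -> 0 <= p.1.
Proof.
move=> pmin P0; rewrite leNgt; apply/negP => p1.
have [i] := P0 (p.1^-1 *: p.2); apply/negP; rewrite -ltNge.
have Pi : convex_hull (range P) (P i) by apply: sub_gen_smallest; exists i.
have := argmin_variational (@convex_convex_hull _ _ _) pmin Pi.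
have p0 : 0 < sqnorm p by rewrite ltr_pwDl ?dotp_ge0// exprn_even_gt0//= lt_eqF.
move=> /(lt_le_trans p0) pPi; rewrite /aff dotpZr -(ltr_nM2r p1) mul0r.
by rewrite mulrDl [_^-1 * _ * _]mulrAC mulVf ?lt_eqF// mul1r.
Qed.

(** When [p.1 = 0], the variational inequality makes [p.2] a direction of common
    ascent, unless [p] is the origin. *)
Lemma argmin_ge0_cases (R : realType) (d n : nat)
    (P : 'I_n.+1 -> R * 'rV[R]_d) (m : R) (p : R * 'rV[R]_d) :
  (forall h, exists i, m <= aff (P i) h) ->
  argmin (@sqnorm R d) (convex_hull (range P)) p ->
  0 <= p.1 -> convex_hull (range P) 0 \/ 0 < p.1.
Proof.
move=> Pm pmin; rewrite le_eqVlt => /predU1P[p1|]; last by right.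
left; suff <- : p = 0 by exact: pmin.1.
apply/sqnorm_eq0/eqP; apply: contrapT => /negP p0.
have {}p0 : 0 < sqnorm p by rewrite lt0r p0 sqnorm_ge0.
apply: (no_common_ascent Pm p0 (u := p.2)) => i.
have Pi : convex_hull (range P) (P i) by apply: sub_gen_smallest; exists i.
have := argmin_variational (@convex_convex_hull _ _ _) pmin Pi.
by rewrite /pdot -p1 mulr0 add0r.
Qed.

(** A point of the hull with zero slope and nonnegative constant term bounds the
    maximum from below by that constant.  Either the origin is one, or the
    zero-slope point given by boundedness is: its pairing with [p], which
    is the product of the two constant terms, is at least [sqnorm p]. *)
Lemma argmin_cases_nonneg (R : realType) (d n : nat)
    (P : 'I_n.+1 -> R * 'rV[R]_d) (m : R) (p : R * 'rV[R]_d) :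
  (forall h, exists i, m <= aff (P i) h) ->
  argmin (@sqnorm R d) (convex_hull (range P)) p ->
  convex_hull (range P) 0 \/ 0 < p.1 ->
  forall h, exists i, 0 <= aff (P i) h.
Proof.
move=> Pm pmin p0 h.
suff [q hq [q2 q1]] : exists2 q, convex_hull (range P) q & q.2 = 0 /\ 0 <= q.1.
  have [i qi] := hull_aff_le h hq; exists i; apply: le_trans qi.
  by rewrite /aff q2 -(scale0r h) dotpZl mul0r addr0.
case: p0 => [h0|p1]; first by exists 0.
have [q hq q2] := hull_zero_slope Pm; exists q; first exact: hq.
split=> //; rewrite -(pmulr_lge0 _ p1).
have := argmin_variational (@convex_convex_hull _ _ _) pmin hq.
rewrite /pdot q2 -(scale0r p.2) dotpZl mul0r addr0.
exact: le_trans (sqnorm_ge0 p).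
Qed.

(** * Piecewise affine functions *)

Lemma le_max_affine (R : realType) (d l : nat) (a : 'I_l.+1 -> R)
    (v : 'I_l.+1 -> 'rV[R]_d) (x : 'rV[R]_d) (i : 'I_l.+1) :
  a i + dotp (v i) x <= max_affine a v x.
Proof. exact: (le_bigmax _ (fun i => a i + dotp (v i) x)). Qed.

Lemma max_affine_attained (R : realType) (d l : nat) (a : 'I_l.+1 -> R)
    (v : 'I_l.+1 -> 'rV[R]_d) (x : 'rV[R]_d) :
  exists i, max_affine a v x = a i + dotp (v i) x.
Proof.
rewrite /max_affine; elim/big_ind: _ => [|y t [i ->] [k ->]|i _].
- by exists ord0.
- by rewrite maxEle; case: ifP; [exists k|exists i].
- by exists i.
Qed.

Lemma min_affine_le (R : realType) (d s : nat) (b : 'I_s.+1 -> R)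
    (w : 'I_s.+1 -> 'rV[R]_d) (x : 'rV[R]_d) (j : 'I_s.+1) :
  min_affine b w x <= b j + dotp (w j) x.
Proof. exact: (bigmin_le _ _ (fun j => b j + dotp (w j) x)). Qed.

Lemma min_affine_attained (R : realType) (d s : nat) (b : 'I_s.+1 -> R)
    (w : 'I_s.+1 -> 'rV[R]_d) (x : 'rV[R]_d) :
  exists j, min_affine b w x = b j + dotp (w j) x.
Proof.
rewrite /min_affine; elim/big_ind: _ => [|y t [i ->] [k ->]|i _].
- by exists ord0.
- by rewrite minEle; case: ifP; [exists i|exists k].
- by exists i.
Qed.

Definition shifted_gen (R : realType) (d l : nat) (a : 'I_l.+1 -> R)
    (v : 'I_l.+1 -> 'rV[R]_d) (x : 'rV[R]_d) (z : R * 'rV[R]_d) (i : 'I_l.+1) :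
    R * 'rV[R]_d :=
  (a i - max_affine a v x + dotp (v i) x, v i) + z.

(** The difference between the function at [xs + h] and at [xs] is the minimum
    over [j] of the maximum over [i] of [aff (shifted_gen a v xs (z j) i) h].
    Keeping [m] arbitrary covers both global minimality ([m = 0]) and
    boundedness below. *)
Lemma global_lower_boundP (R : realType) (d l s : nat)
    (a : 'I_l.+1 -> R) (v : 'I_l.+1 -> 'rV[R]_d)
    (b : 'I_s.+1 -> R) (w : 'I_s.+1 -> 'rV[R]_d) (xs : 'rV[R]_d)
    (z : 'I_s.+1 -> R * 'rV[R]_d)
    (hz : forall j, z j = (b j - min_affine b w xs + dotp (w j) xs, w j))
    (m : R) :
  (forall x, max_affine a v xs + min_affine b w xs + m <=
             max_affine a v x + min_affine b w x) <->
  (forall j h, exists i, m <= aff (shifted_gen a v xs (z j) i) h).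
Proof.
have affE j i h : aff (shifted_gen a v xs (z j) i) h =
    (a i + dotp (v i) (xs + h)) + (b j + dotp (w j) (xs + h)) -
    (max_affine a v xs + min_affine b w xs).
  by rewrite hz /aff /shifted_gen /= dotpDl !dotpDr; ring.
split=> [fm j h|gm x].
- have [i iE] := max_affine_attained a v (xs + h); exists i.
  rewrite affE -iE; have := fm (xs + h).
  have := min_affine_le b w (xs + h) j; lra.
- have [j jE] := min_affine_attained b w x.
  have [i] := gm j (x - xs); rewrite affE [xs + _]addrC subrK -jE.
  have := le_max_affine a v x i; lra.
Qed.

Theorem theorem4p5 (R : realType) (d l s : nat)
    (a : 'I_l.+1 -> R) (v : 'I_l.+1 -> 'rV[R]_d)
    (b : 'I_s.+1 -> R) (w : 'I_s.+1 -> 'rV[R]_d)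
    (f : 'rV[R]_d -> R)
    (hf : forall x, f x = max_affine a v x + min_affine b w x)
    (xs : 'rV[R]_d)
    (hbnd : has_lbound (range f))
    (z : 'I_s.+1 -> R * 'rV[R]_d)
    (hz : forall j, z j = (b j - min_affine b w xs + dotp (w j) xs, w j)) :
  [/\ forall j, hyperdiff b w xs (z j),
      forall j, exists p : R * 'rV[R]_d,
        [set p] = argmin (@sqnorm R d) (translate (hypodiff a v xs) (z j))
    & forall hat : 'I_s.+1 -> R * 'rV[R]_d,
        (forall j, [set hat j] =
          argmin (@sqnorm R d) (translate (hypodiff a v xs) (z j))) ->
        [<-> forall x, f xs <= f x;
             forall j, 0 <= (hat j).1;
             forall j, translate (hypodiff a v xs) (z j) 0 \/ 0 < (hat j).1]].
Proof.
have tE j : translate (hypodiff a v xs) (z j) =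
    convex_hull (range (shifted_gen a v xs (z j))).
  exact: translate_convex_hull.
split=> [j|j|hat hatP].
- by apply: sub_gen_smallest; exists j => //; rewrite hz.
- have [p pmin] := argmin_hull_exists (shifted_gen a v xs (z j)).
  exists p; rewrite tE; apply: argmin_sqnorm_unique pmin.
  exact: convex_convex_hull.
have hatmin j : argmin (@sqnorm R d)
    (convex_hull (range (shifted_gen a v xs (z j)))) (hat j).
  by rewrite -tE -hatP.
have [m fm] := hbnd.
have bnd j h : exists i, m - f xs <= aff (shifted_gen a v xs (z j) i) h.
  apply: ((global_lower_boundP a v hz _).1 _ j h) => x.
  by rewrite -!hf addrC subrK; apply: fm; exists x.
have minP : (forall x, f xs <= f x) <->
    (forall j h, exists i, 0 <= aff (shifted_gen a v xs (z j) i) h).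
  rewrite -(global_lower_boundP a v hz 0).
  by split=> fx x; have := fx x; rewrite !hf addr0.
tfae.
- by move=> /minP g0 j; exact: nonneg_argmin_ge0 (hatmin j) (g0 j).
- by move=> h0 j; rewrite tE; exact: argmin_ge0_cases (bnd j) (hatmin j) (h0 j).
- move=> h0; apply/minP => j; apply: argmin_cases_nonneg (bnd j) (hatmin j) _.
  by rewrite -tE; exact: h0.
Qed.
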